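(* Let $c\ge1$ and $m\ge0$ be integers, and let $G$ be a circular graph with a transparent ordered $c$-edge-colouring. Suppose that for any $i,j\in\{1,\dots,c\}$ with $i<j$ and for any edge $e$ of colour $i$, the matching number of the set of edges of colour $j$ that cross $e$ is at most $m$. Then the treewidth of $G$ satisfies $\mathrm{tw}(G)\leq 9mc(c-1)+3c-1$.
   Context: Graphs are finite, simple and undirected. A topological graph is a graph whose vertices are distinct points in the plane, where each edge $vw$ is a non-self-intersecting curve between $v$ and $w$, such that no edge passes through any vertex different from its endpoints, each pair of edges intersect at a finite number of points, and no three edges internally intersect at a common point. A crossing of distinct edges is an internal intersection point of them; two edges cross if they have at least one crossing. A geometric graph is a topological graph in which every edge is a straight line segment. A circular graph is a geometric graph with its vertices positioned on a circle. An ordered $c$-edge-colouring of $G$ is a function $\phi:E(G)\to\{1,\dots,c\}$ (edges of the same colour may share endpoints). It is transparent if no two edges of the same colour cross. The matching number of a set $E$ of edges is the size of a largest set of pairwise vertex-disjoint edges in $E$. *)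

(* Defs.v *)
From mathcomp Require Import all_boot all_order all_algebra.
From mathcomp Require Import all_classical all_reals all_analysis.

Set Implicit Arguments.
Unset Strict Implicit.
Unset Printing Implicit Defensive.

Import Order.TTheory GRing.Theory Num.Theory.
Import numFieldNormedType.Exports.

Local Open Scope ring_scope.

Record sgraph := SGraph {
  vertex :> finType;
  adj : rel vertex;
  adj_sym : symmetric adj;
  adj_irrefl : irreflexive adj }.

Definition edges (G : sgraph) : {set {set G}} :=
  [set [set p.1; p.2]%SET | p : G * G & adj p.1 p.2]%SET.

Definition matching_number (V : finType) (F : {set {set V}}) : nat :=
  \max_(M : {set {set V}} | (M \subset F) && finset.trivIset M) #|M|.

Definition connected_graph (G : sgraph) : Prop :=
  (0 < #|G|)%N /\ forall x y : G, connect (@adj G) x y.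

Definition acyclic (G : sgraph) : Prop :=
  forall s : seq G, (2 < size s)%N -> ~ ucycle (@adj G) s.

Definition is_tree (G : sgraph) : Prop := connected_graph G /\ acyclic G.

Record tree_decomposition (G T : sgraph) (B : T -> {set G}) : Prop := {
  td_tree : is_tree T;
  td_vertex : forall v : G, exists t : T, v \in B t;
  td_edge : forall e, e \in edges G -> exists t : T, e \subset B t;
  td_connected : forall (v : G) (s t : T), v \in B s -> v \in B t ->
    connect [rel x y : T | [&& adj x y, v \in B x & v \in B y]] s t }.

(* The predecessor only truncates when [G] has no vertex: such a graph
   gets treewidth 0 instead of -1. *)
Definition td_width (G T : sgraph) (B : T -> {set G}) : nat :=
  (\max_(t : T) #|B t|).-1.

Definition has_td_of_width (G : sgraph) (k : nat) : Prop :=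
  exists (T : sgraph) (B : T -> {set G}),
    tree_decomposition B /\ td_width B = k.

Lemma has_td (G : sgraph) : exists k, `[< has_td_of_width G k >].
Proof.
have s0 : symmetric (fun _ _ : unit => false) by [].
have i0 : irreflexive (fun _ _ : unit => false) by [].
pose T := SGraph s0 i0; pose B (_ : T) := [set: G]%SET.
exists (td_width B); apply/asboolP; exists T, B; split=> //; split.
- split; first by split; [rewrite card_unit | move=> [] []; exact: connect0].
  by move=> [|x [|y s]] //= _ /andP[].
- by move=> v; exists tt; rewrite finset.in_setT.
- by move=> e _; exists tt; apply: finset.subsetT.
- by move=> v [] [] _ _; exact: connect0.
Qed.

Definition treewidth (G : sgraph) : nat := ex_minn (has_td G).

Section Drawings.
Variable R : realType.

Definition arc_between (p q : R * R) (A : set (R * R)) : Prop :=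
  exists f : R -> R * R,
    [/\ {within `[0, 1], continuous f}%classic,
        {in `[0, 1] &, injective f},
        f 0 = p, f 1 = q & A = (f @` `[0, 1])%classic].

Definition segment (p q : R * R) : set (R * R) :=
  [set (1 - t) *: p + t *: q | t in `[0, 1]]%classic.

Definition curve_interior (G : sgraph) (pos : G -> R * R)
    (curve : {set G} -> set (R * R)) (e : {set G}) : set (R * R) :=
  (curve e `\` [set pos v | v in [set` e]])%classic.

(* Only the values of [curve] on the edges of the graph are meaningful. *)
Record topological_graph := TopologicalGraph {
  tg_graph :> sgraph;
  pos : tg_graph -> R * R;
  curve : {set tg_graph} -> set (R * R);
  pos_inj : injective pos;
  curve_arc : forall u v : tg_graph, adj u v ->
    arc_between (pos u) (pos v) (curve [set u; v]%SET);
  curve_vertex : forall (e : {set tg_graph}) (w : tg_graph),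
    e \in edges tg_graph -> curve e (pos w) -> w \in e;
  curve_finite : forall e f : {set tg_graph},
    e \in edges tg_graph -> f \in edges tg_graph -> e != f ->
    finite_set (curve e `&` curve f)%classic;
  curve_no_triple : forall e f g : {set tg_graph},
    e \in edges tg_graph -> f \in edges tg_graph -> g \in edges tg_graph ->
    e != f -> e != g -> f != g ->
    forall x, ~ [/\ curve_interior pos curve e x,
                    curve_interior pos curve f x &
                    curve_interior pos curve g x] }.

Definition crosses (G : topological_graph) (e f : {set G}) : Prop :=
  e != f /\ exists x, curve_interior (@pos G) (@curve G) e x /\
                      curve_interior (@pos G) (@curve G) f x.

Definition geometric (G : topological_graph) : Prop :=
  forall u v : G, adj u v ->
    curve [set u; v]%SET = segment (pos u) (pos v).

Definition circular (G : topological_graph) : Prop :=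
  geometric G /\
  exists (o : R * R) (r : R), 0 < r /\
    forall v : G,
      ((pos v).1 - o.1) ^+ 2 + ((pos v).2 - o.2) ^+ 2 = r ^+ 2.

(* A colouring is a total function on vertex sets of which only the values
   on [edges G] matter; the ordered palette is ['I_c]. *)
Definition transparent (G : topological_graph) (c : nat)
    (phi : {set G} -> 'I_c) : Prop :=
  forall e f : {set G}, e \in edges G -> f \in edges G ->
    phi e = phi f -> ~ crosses e f.

Definition crossing_edges_of_colour (G : topological_graph) (c : nat)
    (phi : {set G} -> 'I_c) (e : {set G}) (j : 'I_c) : {set {set G}} :=
  [set f in edges G | (phi f == j) && `[< crosses e f >]]%SET.

End Drawings.

(* Main.v *)
Require Import Defs.
From mathcomp Require Import all_boot all_order all_algebra.
From mathcomp Require Import all_classical all_reals all_analysis.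
From mathcomp Require Import zify ring lra.
From mathcomp Require Import fintype finset.

(** Number the vertices in their order along the circle.  Two edges whose ends
    interleave do cross as straight segments ([interleave_crosses]).  The rest
    is about chords of a polygon.

    Say that a pair of positions [x], [y] is guarded if there is a list [D] of
    edges such that every edge crossing the chord [xy] crosses an edge of [D]
    of smaller colour.  The edges of a later colour that cross [d] in [D] have
    matching number at most [m], so they are covered by the at most [2m] ends
    of a maximum matching.  Hence few vertices cover all edges crossing [xy],
    provided [D] is short.

    The heart of the proof is that the polygon of all positions has a
    triangulation all of whose chords are guarded by two lists, one for each
    end of the chord, along each of which the colours strictly increase
    ([guarded_triangulation]).  Geometrically, join a point inside the disc
    to the circle by walking along an edge until it meets an edge of smaller
    colour, turning onto that edge, and so on until an end of an edge is
    reached.  Only edges of larger colour cross the walk.  A chord stands for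
    the union of two walks that start next to each other.  The formal argument
    cuts the disc along an edge [e] of the smallest colour, contracts what lies
    on the far side of [e] to a single new corner, triangulates both halves by
    induction, and then moves the new corner to an end of [e], adding [e] to
    the lists of that corner.

    Strictly increasing colours in [1..c] give at most
    [sum_i 2m(c - i) = mc(c - 1)] covering vertices for each end
    ([colour_budget]), so every chord of the triangulation has a cover with at
    most [2mc(c - 1)] vertices.  A tree decomposition is obtained with one bag
    for each triangle: its three corners and a cover for each of its three
    sides ([extend_decomposition]).  For the bags containing a given vertex to
    be connected, the covers must be nested along the triangulation; minimum
    covers can be chosen so, because they uncross ([uncross_min_cover]).  The
    bags have at most [3 + 6mc(c - 1)] vertices, so the width is at most
    [6mc(c - 1) + 2], which is within the required bound as [c >= 1]. *)

Set Implicit Arguments.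
Unset Strict Implicit.
Unset Printing Implicit Defensive.

(** * Triangulated polygons *)

(** Corners of a polygon are natural numbers, in circular order; this is crossing
    of the chords [ab] and [xy], where chords with a common end do not cross. *)
Definition interleave (a b x y : nat) : bool :=
  let inside z := (minn a b < z < maxn a b)%N in
  let outside z := (z < minn a b)%N || (maxn a b < z)%N in
  inside x && outside y || inside y && outside x.

(** A triangulation of the polygon whose corners are those of [P] in [[x, y]],
    as seen from its side [xy]: [tri_split] is the triangle on [xy].  The
    predicate [ok] is imposed on all sides and diagonals. *)
Inductive triangulated (P : pred nat) (ok : nat -> nat -> Prop) :
    nat -> nat -> Prop :=
| tri_side x y : ok x y -> (forall w, P w -> ~~ (x < w < y)%N) ->
    triangulated P ok x y
| tri_split x w y : ok x y -> P w -> (x < w < y)%N ->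
    triangulated P ok x w -> triangulated P ok w y -> triangulated P ok x y.

Lemma triangulated_all (P : pred nat) (ok : nat -> nat -> Prop) x y :
  (forall a b, P a -> P b -> (a < b)%N -> ok a b) ->
  P x -> P y -> (x < y)%N -> triangulated P ok x y.
Proof.
move=> okP; have [k] := ubnP (y - x); elim: k x y => // k IH x y le_k Px Py xy.
have [[w [Pw xwy]]|noW] := pselect (exists w, P w /\ (x < w < y)%N).
  apply: (@tri_split _ _ x w y) => //; first exact: okP.
    by apply: IH => //; lia.
  by apply: IH => //; lia.
apply: tri_side; first exact: okP.
by move=> w Pw; apply/negP => xwy; apply: noW; exists w.
Qed.

(** Identifying corners of a triangulated polygon triangulates the image: a
    triangle two of whose corners become equal disappears.  The hypothesis on
    the sides of the first polygon asks for a triangulation, and not just for a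
    side of the second, so that another polygon can be glued there. *)
Lemma triangulated_image (P Q : pred nat) (ok ok' : nat -> nat -> Prop)
    (h : nat -> nat) x y :
  (forall a, P a -> Q (h a)) ->
  (forall a b, P a -> P b -> (a <= b)%N -> (h a <= h b)%N) ->
  (forall a b, ok a b -> [/\ P a, P b & (a < b)%N]) ->
  (forall a b, ok a b -> (h a < h b)%N -> ok' (h a) (h b)) ->
  (forall a b, ok a b -> (h a < h b)%N ->
     (forall w, P w -> ~~ (a < w < b)%N) -> triangulated Q ok' (h a) (h b)) ->
  triangulated P ok x y -> (h x < h y)%N -> triangulated Q ok' (h x) (h y).
Proof.
move=> hQ hmono okP hok hside; elim=> {x y} [x y okxy sxy hxy|].
  exact: hside.
move=> x w y okxy Pw /andP[xw wy] _ IHl _ IHr hxy.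
have [Px Py _] := okP _ _ okxy.
have hxw := hmono _ _ Px Pw (ltnW xw); have hwy := hmono _ _ Pw Py (ltnW wy).
have [e|ne] := eqVneq (h x) (h w); first by rewrite e; apply: IHr; rewrite -e.
have [e|ne'] := eqVneq (h w) (h y); first by rewrite -e; apply: IHl; rewrite e.
have lt1 : (h x < h w)%N by rewrite ltn_neqAle ne.
have lt2 : (h w < h y)%N by rewrite ltn_neqAle ne'.
by apply: (tri_split (w := h w)); rewrite ?lt1 //; auto.
Qed.

Lemma interleaveC a b x y : interleave a b x y = interleave a b y x.
Proof. by rewrite /interleave orbC. Qed.

Lemma interleaveCl a b x y : interleave a b x y = interleave b a x y.
Proof. by rewrite /interleave minnC maxnC. Qed.

Lemma interleaveS a b x y : interleave a b x y = interleave x y a b.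
Proof.
rewrite /interleave /minn /maxn; have [ab|ba] := ltnP a b.
  by have [xy|yx] := ltnP x y; lia.
by have [xy|yx] := ltnP x y; lia.
Qed.

(** * Contracting one side of a chord *)

(** The chord [uv] cuts a polygon in two.  Each half keeps its own corners, plus
    one new corner that stands for all corners strictly on the other side:
    [v.+1] for the half [[u, v]], and [u.+1] for the other half.  Neither label
    is in use in its half, whatever the polygon.  Then [relabel] puts the new
    corner back on an end of [uv], so that the two halves can be glued. *)
Definition relabel (z s x : nat) : nat := if x == z then s else x.
Definition collapse_out (u v x : nat) : nat := if (u <= x <= v)%N then x else v.+1.
Definition collapse_in (u v x : nat) : nat := if (u < x < v)%N then u.+1 else x.

Section CollapseArith.
Variables (u v : nat).

Lemma collapse_out_interleave a b x y (f := collapse_out u v) :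
  interleave (f a) (f b) (f x) (f y) -> interleave a b x y.
Proof. by rewrite /interleave /f /collapse_out /=; do ?[case: ifP => ?]; lia. Qed.

Lemma collapse_in_interleave a b x y (f := collapse_in u v) :
  interleave (f a) (f b) (f x) (f y) -> interleave a b x y.
Proof. by rewrite /interleave /f /collapse_in /=; do ?[case: ifP => ?]; lia. Qed.

(** An edge that crosses some chord of a half and ends at its new corner comes
    from an edge that crosses [uv]. *)
Lemma collapse_out_new a b x y (f := collapse_out u v) :
  (u <= x <= v.+1)%N -> (u <= y <= v.+1)%N -> f a = v.+1 ->
  interleave (f a) (f b) x y -> interleave u v a b.
Proof. by rewrite /interleave /f /collapse_out /=; do ?[case: ifP => ?]; lia. Qed.

Lemma collapse_in_new a b x y (f := collapse_in u v) :
  (u.+1 < v)%N -> (x <= u.+1)%N || (v <= x)%N -> (y <= u.+1)%N || (v <= y)%N ->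
  f a = u.+1 ->
  interleave (f a) (f b) x y -> interleave u v a b.
Proof. by rewrite /interleave /f /collapse_in /=; do ?[case: ifP => ?]; lia. Qed.

(** After relabelling, all chords of a half lie weakly on one side of [uv]. *)
Lemma relabel_out_self x y (h := relabel v.+1 v) : (u <= v)%N ->
  (u <= x <= v.+1)%N -> (u <= y <= v.+1)%N -> ~~ interleave (h x) (h y) u v.
Proof. by rewrite /interleave /h /relabel /=; do ?[case: ifP => ?]; lia. Qed.

Lemma relabel_in_self x y (h := relabel u.+1 u) : (u <= v)%N ->
  (x <= u.+1)%N || (v <= x)%N -> (y <= u.+1)%N || (v <= y)%N ->
  ~~ interleave (h x) (h y) u v.
Proof. by rewrite /interleave /h /relabel /=; do ?[case: ifP => ?]; lia. Qed.

(** Moving the new corner to an end of [uv] sweeps part of [uv] only, so an edge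
    that the chord [xy] meets after the move but not before crosses [uv]. *)
Lemma relabel_out_interleave a b x y
    (f := collapse_out u v) (h := relabel v.+1 v) :
  (u <= x <= v.+1)%N -> (u <= y <= v.+1)%N -> (x < y)%N -> (h x < h y)%N ->
  interleave (h x) (h y) a b -> ~~ interleave x y (f a) (f b) ->
  interleave u v a b /\ ((x == v.+1) || (y == v.+1)).
Proof.
by rewrite /interleave /f /h /collapse_out /relabel /=; do ?[case: ifP => ?]; lia.
Qed.

Lemma relabel_in_interleave a b x y
    (f := collapse_in u v) (h := relabel u.+1 u) :
  (u.+1 < v)%N -> (x <= u.+1)%N || (v <= x)%N -> (y <= u.+1)%N || (v <= y)%N ->
  (x < y)%N -> (h x < h y)%N ->
  interleave (h x) (h y) a b -> ~~ interleave x y (f a) (f b) ->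
  interleave u v a b /\ ((x == u.+1) || (y == u.+1)).
Proof.
by rewrite /interleave /f /h /collapse_in /relabel /=; do ?[case: ifP => ?]; lia.
Qed.

End CollapseArith.

(** * Triangulations with guarded chords *)

Section Cutting.
Variables (E : eqType) (col : E -> nat).

(** Edges are labels [g] with ends [l g] and [r g], as the ends change when the
    polygon is contracted; distinct labels may get the same ends.  The lists
    [Dx] and [Dy] record the edges met by the walks towards [x] and [y], listed
    from the circle inwards.  The number [lev x] is smaller than the colour of
    every edge that ends at [x] and crosses something.  At a corner made by
    contracting the far side of an edge it is the colour of that edge, which
    can therefore be put in front of [Dx]. *)
Definition guarded (es : seq E) (P : pred nat) (l r : E -> nat)
    (lev : nat -> nat) (x y : nat) : Prop :=
  [/\ P x, P y, (x < y)%N &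
   exists Dx Dy : seq E,
    [/\ {subset Dx ++ Dy <= es},
        path ltn (lev x) (map col Dx), path ltn (lev y) (map col Dy) &
        forall g, g \in es -> interleave x y (l g) (r g) ->
          exists2 d, d \in Dx ++ Dy &
            interleave (l d) (r d) (l g) (r g) /\ (col d < col g)%N]].

(** What the two halves of a polygon cut along [e] have in common: [f] maps the
    corners in [P] to those of a half [P'], [z] is the new corner of this half,
    and [s] is the end of [e] that [z] is moved to. *)
Section Collapse.
Variables (es : seq E) (e : E) (P P' : pred nat) (l r : E -> nat).
Variables (lev f : nat -> nat) (z s : nat).

Let lev' x := if x == z then col e else lev x.
Let h := relabel z s.

Hypothesis e_min : forall g, g \in es -> (col e <= col g)%N.
Hypothesis P_ends : forall g, g \in es -> P (l g) /\ P (r g).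
Hypothesis transp : forall g g', g \in e :: es -> g' \in e :: es ->
  col g = col g' -> ~~ interleave (l g) (r g) (l g') (r g').
Hypothesis levP : forall g x y, g \in es -> P x -> P y ->
  interleave (l g) (r g) x y -> (lev (l g) < col g)%N /\ (lev (r g) < col g)%N.

Hypothesis P's : forall x, P' x -> x != z -> P x.
Hypothesis lift : forall x, P' x -> exists2 x', P x' & f x' = x.
Hypothesis f_id : forall x, f x != z -> f x = x.
Hypothesis f_interleave : forall a b x y,
  interleave (f a) (f b) (f x) (f y) -> interleave a b x y.
Hypothesis z_cross : forall a b x y, P a -> P b -> P' x -> P' y -> f a = z ->
  interleave (f a) (f b) x y -> interleave (l e) (r e) a b.
Hypothesis Ps : P s.
Hypothesis lev_s : (lev s < col e)%N.
Hypothesis h_e : forall x y, P' x -> P' y ->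
  ~~ interleave (h x) (h y) (l e) (r e).
Hypothesis h_cross : forall a b x y, P a -> P b -> P' x -> P' y -> (x < y)%N ->
  (h x < h y)%N -> interleave (h x) (h y) a b ->
  ~~ interleave x y (f a) (f b) ->
  interleave (l e) (r e) a b /\ ((x == z) || (y == z)).

(** Edges of equal colour do not cross, and [e] has the smallest colour. *)
Lemma lt_col_of_cross g : g \in es -> interleave (l e) (r e) (l g) (r g) ->
  (col e < col g)%N.
Proof.
move=> ges; apply: contraLR; rewrite -leqNgt => le.
apply: transp; rewrite ?mem_head ?inE ?ges ?orbT //.
by apply/eqP; rewrite eqn_leq le e_min.
Qed.

(** An edge that ends at the new corner and crosses a chord of the half comes
    from an edge crossing [e], hence has a larger colour. *)
Lemma collapse_lev g x y : g \in es -> P' x -> P' y ->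
  interleave (f (l g)) (f (r g)) x y ->
  (lev' (f (l g)) < col g)%N /\ (lev' (f (r g)) < col g)%N.
Proof.
move=> ges P'x P'y X; have [Pl Pr] := P_ends ges.
have [x' Px' fx] := lift P'x; have [y' Py' fy] := lift P'y.
have [ll lr] : (lev (l g) < col g)%N /\ (lev (r g) < col g)%N.
  by apply: (levP ges Px' Py'); apply: f_interleave; rewrite fx fy.
split; rewrite /lev'; case: eqP => [fz|/eqP/f_id->//]; apply: lt_col_of_cross => //.
  exact: (z_cross Pl Pr P'x P'y fz X).
by rewrite interleaveC; apply: (z_cross Pr Pl P'x P'y fz); rewrite interleaveCl.
Qed.

(** Moving [z] to [s] keeps chords guarded once [e] is added to the list of [z]:
    the edges that are newly crossed all cross [e]. *)
Lemma collapse_guarded x y :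
  guarded es P' (f \o l) (f \o r) lev' x y -> (h x < h y)%N ->
  guarded (e :: es) P l r lev (h x) (h y).
Proof.
move=> [P'x P'y xy [Dx [Dy [sD px py D]]]] hxy.
have Ph w : P' w -> P (h w) by rewrite /h /relabel; case: eqVneq => // ne /P's; apply.
pose X w Dw : seq E := if w == z then e :: Dw else Dw.
have pX w Dw : path ltn (lev' w) (map col Dw) ->
    path ltn (lev (h w)) (map col (X w Dw)).
  by rewrite /lev' /h /relabel /X; case: eqP => //= _ ->; rewrite lev_s.
have sX w Dw d : d \in Dw -> d \in X w Dw.
  by rewrite /X; case: ifP => // _ dD; rewrite inE dD orbT.
split; [exact: Ph|exact: Ph|by []|exists (X x Dx), (X y Dy); split; auto].
  move=> d; have sub w Dw : d \in X w Dw -> d \in e :: Dw.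
    by rewrite /X; case: ifP => // _; rewrite inE orbC => ->.
  rewrite mem_cat inE => /orP[] /sub; rewrite inE => /orP[->//|dD];
    by rewrite [d \in es]sD ?orbT // mem_cat dD ?orbT.
move=> g; rewrite inE => /orP[/eqP->|ges].
  by move=> H; have := h_e P'x P'y; rewrite H.
have [Pl Pr] := P_ends ges.
move=> gxy; have [gX|gX] := boolP (interleave x y (f (l g)) (f (r g))).
  have [d dD [dg lt]] := D _ ges gX; exists d.
    by move: dD; rewrite !mem_cat => /orP[] /sX ->; rewrite ?orbT.
  by split=> //; apply: f_interleave.
have [eg xz] := h_cross Pl Pr P'x P'y xy hxy gxy gX.
exists e; last by split=> //; apply: lt_col_of_cross.
by rewrite mem_cat /X; case/orP: xz => ->; rewrite mem_head ?orbT.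
Qed.

End Collapse.

(** By induction on the number of edges, taken by increasing colour.  If the
    first edge [e] crosses no chord, it can be dropped.  Otherwise both halves
    of the polygon cut along [e] have one edge less, as [e] becomes invisible
    to their chords after the new corners are moved to ends of [e]; the two
    triangulations are glued along [e]. *)
Lemma guarded_triangulation (es : seq E) (P : pred nat) l r lev lo hi :
  sorted (relpre col leq) es ->
  P lo -> P hi -> (lo < hi)%N -> (forall x, P x -> (lo <= x <= hi)%N) ->
  (forall g, g \in es -> P (l g) /\ P (r g)) ->
  (forall g g', g \in es -> g' \in es -> col g = col g' ->
     ~~ interleave (l g) (r g) (l g') (r g')) ->
  (forall g x y, g \in es -> P x -> P y -> interleave (l g) (r g) x y ->
     (lev (l g) < col g)%N /\ (lev (r g) < col g)%N) ->
  triangulated P (guarded es P l r lev) lo hi.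
Proof.
elim: es P l r lev lo hi => [|e es IH] P l r lev lo hi.
  move=> _ Plo Phi lohi _ _ _ _; apply: triangulated_all => // a b Pa Pb ab.
  by split=> //; exists [::], [::].
move=> srt Plo Phi lohi Pbnd Pend transp levP.
have emin g : g \in es -> (col e <= col g)%N.
  have tr : transitive (relpre col leq) by move=> ? ? ?; apply: leq_trans.
  by move=> ges; have := order_path_min tr srt; move/allP/(_ _ ges).
have srt' : sorted (relpre col leq) es by apply: path_sorted srt.
have sub g : g \in es -> g \in e :: es by rewrite inE orbC => ->.
have Pend' g : g \in es -> P (l g) /\ P (r g) by auto.
have levP' g x y : g \in es -> P x -> P y -> interleave (l g) (r g) x y ->
    (lev (l g) < col g)%N /\ (lev (r g) < col g)%N by move=> /sub; apply: levP.
have [[p [q [Pp Pq epq]]]|nope] :=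
  pselect (exists p q, [/\ P p, P q & interleave (l e) (r e) p q]); last first.
  have W a b : guarded es P l r lev a b -> guarded (e :: es) P l r lev a b.
    case=> Pa Pb ab [Da [Db [sD pa pb D]]]; split=> //; exists Da, Db; split=> //.
      by move=> d /sD; apply: sub.
    move=> g; rewrite inE => /orP[/eqP-> abe|]; last exact: D.
    case: nope; exists a, b; split=> //; by rewrite interleaveS.
  have T : triangulated P (guarded es P l r lev) lo hi.
    by apply: IH => // g g' /sub ges /sub ges'; apply: transp.
  apply: (@triangulated_image P P _ _ id) T lohi => //.
  - by move=> a b [].
  - by move=> a b /W abW _.
  - by move=> a b /W abW _; apply: tri_side.
have [Ple Pre] := Pend e (mem_head _ _).
have [levl levr] := levP e p q (mem_head _ _) Pp Pq epq.
have transp' (f : nat -> nat) :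
    (forall a b x y, interleave (f a) (f b) (f x) (f y) -> interleave a b x y) ->
    forall g g', g \in es -> g' \in es -> col g = col g' ->
    ~~ interleave ((f \o l) g) ((f \o r) g) ((f \o l) g') ((f \o r) g').
  by move=> fI g g' ges ges' /(transp _ _ (sub _ ges) (sub _ ges')); apply/contra/fI.
set u := minn (l e) (r e); set v := maxn (l e) (r e).
have Pu : P u by rewrite /u /minn; case: ifP.
have Pv : P v by rewrite /v /maxn; case: ifP.
have levu : (lev u < col e)%N by rewrite /u /minn; case: ifP.
have levv : (lev v < col e)%N by rewrite /v /maxn; case: ifP.
have euv x y : interleave (l e) (r e) x y = interleave u v x y.
  by rewrite /u /v /minn /maxn; case: ifP => // _; rewrite interleaveCl.
have euv' x y : interleave x y (l e) (r e) = interleave x y u v.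
  by rewrite /u /v /minn /maxn; case: ifP => // _; rewrite interleaveC.
have uv : (u <= v)%N := leq_trans (geq_minl _ _) (leq_maxl _ _).
have [w1 Pw1 uw1v] : exists2 w, P w & (u < w < v)%N.
  by move: epq; rewrite /interleave -/u -/v => /orP[/andP[]|/andP[]] ? ?;
    [exists p|exists q].
have [w2 Pw2 uvw2] : exists2 w, P w & (w < u)%N || (v < w)%N.
  by move: epq; rewrite /interleave -/u -/v => /orP[/andP[]|/andP[]] ? ?;
    [exists q|exists p].
clearbody u v.
(* The half [[u, v]].  Its new corner [v.+1] moves to [v], so its root side,
   from [u] to [v.+1], becomes the chord [uv]. *)
have inner : triangulated P (guarded (e :: es) P l r lev) u v.
  pose P' x := P x && (u <= x <= v)%N || (x == v.+1).
  pose f := collapse_out u v; pose h := relabel v.+1 v.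
  have P'_bnd x : P' x -> (u <= x <= v.+1)%N.
    by rewrite /P' => /orP[/andP[_]|/eqP->]; clear -uv; lia.
  have P_f x : P x -> P' (f x).
    by rewrite /P' /f /collapse_out; case: ifP => [-> ->//|_ _]; rewrite eqxx orbT.
  have fI a b x y : interleave (f a) (f b) (f x) (f y) -> interleave a b x y.
    exact: collapse_out_interleave.
  have P's x : P' x -> x != v.+1 -> P x.
    by rewrite /P' => /orP[/andP[]|->].
  have lift x : P' x -> exists2 x', P x' & f x' = x.
    rewrite /P' /f /collapse_out => /orP[/andP[Px xuv]|/eqP->].
      by exists x => //; rewrite xuv.
    by exists w2 => //; rewrite ifN //; clear -uvw2; lia.
  have f_id x : f x != v.+1 -> f x = x.
    by rewrite /f /collapse_out; case: ifP => //; rewrite eqxx.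
  have P_h x : P' x -> P (h x).
    by rewrite /h /relabel; case: eqVneq => // ne /P's; apply.
  have z_new a b x y : P a -> P b -> P' x -> P' y -> f a = v.+1 ->
      interleave (f a) (f b) x y -> interleave (l e) (r e) a b.
    move=> _ _ /P'_bnd x_bnd /P'_bnd y_bnd fa /(collapse_out_new x_bnd y_bnd fa).
    by rewrite euv.
  have h_self x y : P' x -> P' y -> ~~ interleave (h x) (h y) (l e) (r e).
    by move=> /P'_bnd ? /P'_bnd ?; rewrite euv'; apply: relabel_out_self.
  have h_cross a b x y : P a -> P b -> P' x -> P' y -> (x < y)%N ->
      (h x < h y)%N -> interleave (h x) (h y) a b ->
      ~~ interleave x y (f a) (f b) ->
      interleave (l e) (r e) a b /\ ((x == v.+1) || (y == v.+1)).
    move=> _ _ /P'_bnd ? /P'_bnd ?; rewrite euv; exact: relabel_out_interleave.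
  have ends_f g : g \in es -> P' ((f \o l) g) /\ P' ((f \o r) g).
    by case/Pend' => Pl Pr; split; apply: P_f.
  have P'u : P' u by rewrite /P' Pu leqnn uv.
  have P'v1 : P' v.+1 by rewrite /P' eqxx orbT.
  have T := IH P' (f \o l) (f \o r) _ u v.+1 srt' P'u P'v1 (uv : u < v.+1)%N P'_bnd
    ends_f (transp' f fI)
    (collapse_lev emin Pend' transp levP' lift f_id fI z_new).
  have ok_h a b :
      guarded es P' (f \o l) (f \o r)
        (fun x => if x == v.+1 then col e else lev x) a b ->
      (h a < h b)%N -> guarded (e :: es) P l r lev (h a) (h b).
    exact: (collapse_guarded emin Pend' transp P's fI Pv levv h_self h_cross).
  have hu : h u = u by rewrite /h /relabel ifN //; clear -uv; lia.
  have hv1 : h v.+1 = v by rewrite /h /relabel eqxx.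
  rewrite -[X in triangulated _ _ X]hu -[X in triangulated _ _ _ X]hv1.
  apply: (triangulated_image P_h _ _ ok_h _ T);
    last by rewrite hu hv1; clear -uw1v; lia.
  - move=> a b /P'_bnd a_bnd /P'_bnd b_bnd; move: a_bnd b_bnd.
    by rewrite /h /relabel; clear; do ?[case: ifP => ?]; lia.
  - by move=> a b [].
  move=> a b ok hab side; apply: tri_side; first exact: ok_h.
  move=> w Pw; case: ok => P'a P'b ab _; apply/negP => awb.
  have := side w; have := side v; rewrite /P' Pv Pw leqnn uv.
  move: {P'a} (P'_bnd _ P'a) {P'b} (P'_bnd _ P'b) hab awb; rewrite /h /relabel.
  by clear; do ?[case: ifP => ?]; lia.
(* The other half.  Its new corner [u.+1] moves to [u], so its side from
   [u.+1] to [v] becomes [uv], where the first half is glued. *)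
pose P' x := P x && ~~ (u < x < v)%N || (x == u.+1).
pose f := collapse_in u v; pose h := relabel u.+1 u.
have u1v : (u.+1 < v)%N by clear -uw1v; lia.
have [lou _] := andP (Pbnd _ Pu); have [_ vhi] := andP (Pbnd _ Pv).
have P'_bnd x : P' x -> (x <= u.+1)%N || (v <= x)%N.
  by rewrite /P' => /orP[/andP[_]|/eqP->]; clear; lia.
have P_f x : P x -> P' (f x).
  by rewrite /P' /f /collapse_in; case: ifP => [_ _|-> ->//]; rewrite eqxx orbT.
have fI a b x y : interleave (f a) (f b) (f x) (f y) -> interleave a b x y.
  exact: collapse_in_interleave.
have P's x : P' x -> x != u.+1 -> P x.
  by rewrite /P' => /orP[/andP[]|->].
have lift x : P' x -> exists2 x', P x' & f x' = x.
  rewrite /P' /f /collapse_in => /orP[/andP[Px xuv]|/eqP->].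
    by exists x => //; rewrite ifN.
  by exists w1; rewrite ?uw1v.
have f_id x : f x != u.+1 -> f x = x.
  by rewrite /f /collapse_in; case: ifP => //; rewrite eqxx.
have P_h x : P' x -> P (h x).
  by rewrite /h /relabel; case: eqVneq => // ne /P's; apply.
have z_new a b x y : P a -> P b -> P' x -> P' y -> f a = u.+1 ->
    interleave (f a) (f b) x y -> interleave (l e) (r e) a b.
  move=> _ _ /P'_bnd x_bnd /P'_bnd y_bnd fa /(collapse_in_new u1v x_bnd y_bnd fa).
  by rewrite euv.
have h_self x y : P' x -> P' y -> ~~ interleave (h x) (h y) (l e) (r e).
  by move=> /P'_bnd ? /P'_bnd ?; rewrite euv'; apply: relabel_in_self.
have h_cross a b x y : P a -> P b -> P' x -> P' y -> (x < y)%N ->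
    (h x < h y)%N -> interleave (h x) (h y) a b ->
    ~~ interleave x y (f a) (f b) ->
    interleave (l e) (r e) a b /\ ((x == u.+1) || (y == u.+1)).
  move=> _ _ /P'_bnd ? /P'_bnd ?; rewrite euv; exact: relabel_in_interleave.
have ends_f g : g \in es -> P' ((f \o l) g) /\ P' ((f \o r) g).
  by case/Pend' => Pl Pr; split; apply: P_f.
have P'lo : P' lo by rewrite /P' Plo; clear -lou; lia.
have P'hi : P' hi by rewrite /P' Phi; clear -vhi; lia.
have P'_in x : P' x -> (lo <= x <= hi)%N.
  by rewrite /P' => /orP[/andP[/Pbnd]|/eqP->] //; clear -lou u1v vhi; lia.
have T := IH P' (f \o l) (f \o r) _ lo hi srt' P'lo P'hi lohi P'_in
  ends_f (transp' f fI)
  (collapse_lev emin Pend' transp levP' lift f_id fI z_new).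
have ok_h a b :
    guarded es P' (f \o l) (f \o r)
      (fun x => if x == u.+1 then col e else lev x) a b ->
    (h a < h b)%N -> guarded (e :: es) P l r lev (h a) (h b).
  exact: (collapse_guarded emin Pend' transp P's fI Pu levu h_self h_cross).
have hlo : h lo = lo by rewrite /h /relabel ifN //; clear -lou; lia.
have hhi : h hi = hi by rewrite /h /relabel ifN //; clear -u1v vhi; lia.
rewrite -[X in triangulated _ _ X]hlo -[X in triangulated _ _ _ X]hhi.
apply: (triangulated_image P_h _ _ ok_h _ T); last by rewrite hlo hhi.
- move=> a b /P'_bnd a_bnd /P'_bnd b_bnd; move: a_bnd b_bnd.
  by rewrite /h /relabel; clear -u1v; do ?[case: ifP => ?]; lia.
- by move=> a b [].
move=> a b ok hab side; case: (ok) => P'a P'b ab _.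
have [/andP[/eqP au /eqP bv]|nuv] := boolP ((a == u.+1) && (b == v)).
  by rewrite au bv /h /relabel eqxx ifN //; clear -u1v; lia.
apply: tri_side; first exact: ok_h.
move=> w Pw; apply/negP => awb.
have := side w; have := side v; have := side u.+1; rewrite /P' Pv Pw eqxx.
move: {P'a} (P'_bnd _ P'a) {P'b} (P'_bnd _ P'b) hab awb nuv; rewrite /h /relabel.
by clear -u1v; do ?[case: ifP => ?]; lia.
Qed.
End Cutting.

(** * Tree decompositions from the running intersection property *)

Definition bag_union (V : finType) (l : seq {set V}) : {set V} :=
  \bigcup_(B <- l) B.

(** The most recent bag comes first.  Each bag meets the union of the older ones
    inside a single older bag, which becomes its neighbour in the tree. *)
Fixpoint running_intersection (V : finType) (l : seq {set V}) : bool :=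
  if l is B :: l' then
    ((l' == [::]) || has (fun p : {set V} => B :&: bag_union l' \subset p) l')
      && running_intersection l'
  else true.

Lemma mem_bag_union (V : finType) (l : seq {set V}) (v : V) :
  (v \in bag_union l) = has (fun B : {set V} => v \in B) l.
Proof.
elim: l => [|B l IH]; rewrite /bag_union ?big_nil ?big_cons ?inE //.
by rewrite -/(bag_union l) IH.
Qed.

Section RunningIntersectionTree.
Variables (V : finType) (B0 : {set V}) (l0 : seq {set V}).
Let l := B0 :: l0.
Hypothesis l_run : running_intersection l.

Let bag i := nth set0 l i.
(* The parent of a bag has a larger index, as the list is in reverse order. *)
Let par i := i.+1 +
  find (fun p : {set V} => bag i :&: bag_union (drop i.+1 l) \subset p)
    (drop i.+1 l).

Let par_gt i : (i < par i)%N. Proof. by rewrite /par leq_addr. Qed.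

Let par_spec i : (i.+1 < size l)%N ->
  (par i < size l)%N /\ bag i :&: bag_union (drop i.+1 l) \subset bag (par i).
Proof.
move=> lt_i; have : running_intersection (drop i l).
  elim: i l l_run {lt_i} => [|i IH] [|B l'] //.
  by move=> /= /andP[_ /IH].
rewrite (drop_nth set0) ?(ltnW lt_i) //= => /andP[/orP[/eqP d0|Hhas] _].
  by have := congr1 size d0; rewrite size_drop /=; move: lt_i => /=; lia.
have lt_find := Hhas; rewrite has_find size_drop in lt_find.
split; first by rewrite /par -ltn_subRL.
by rewrite [bag (par i)]/bag /par -nth_drop; apply: (nth_find set0 Hhas).
Qed.

Let node := 'I_(size l).
Definition parent_adj : rel node := [rel i j : node | (par i == j) || (par j == i)].

Lemma parent_adj_sym : symmetric parent_adj.
Proof. by move=> i j; rewrite /parent_adj /= orbC. Qed.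

Lemma parent_adj_irrefl : irreflexive parent_adj.
Proof. by move=> i; rewrite /parent_adj /= orbb gtn_eqF. Qed.

Definition parent_tree : sgraph := SGraph parent_adj_sym parent_adj_irrefl.

(** On a cycle the bag of least index would have two distinct neighbours of
    larger index, but it has only one parent. *)
Lemma parent_treeP : is_tree parent_tree.
Proof.
split.
  split; first by rewrite card_ord.
  have to_root (i : node) : connect parent_adj i ord_max.
    have [k] := ubnP (size l - i); elim: k i => // k IH i le_k.
    have [lt_i|ge_i] := ltnP i.+1 (size l); last first.
      suff -> : i = ord_max by [].
      by apply: val_inj; apply/eqP; rewrite eqn_leq -ltnS ltn_ord; exact: ge_i.
    have [lt_p _] := par_spec lt_i; have gt_p := par_gt i.
    have lt_k : (size l - par i < k)%N by clear -le_k lt_p gt_p; lia.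
    apply: connect_trans (connect1 _) (IH (Ordinal lt_p) lt_k).
    by rewrite /parent_adj /= eqxx.
  move=> x y; apply: connect_trans (to_root x) _.
  by rewrite (sym_connect_sym parent_adj_sym).
move=> s s_gt2 /andP[s_cyc s_uniq].
have [x0 x0s] : exists x, x \in s.
  by case: s s_gt2 {s_cyc s_uniq} => // x s; exists x; rewrite mem_head.
case: (@arg_minnP _ x0 [in s] (fun i : node => val i) x0s) => x xs x_min.
have [k s' def_s] := rot_to xs.
move: s_cyc s_uniq s_gt2; rewrite -(rot_cycle k) -(rot_uniq k) -(size_rot k) def_s.
have s'_ge y : y \in s' -> (x <= y)%N.
  move=> ys'; have ys : y \in s by rewrite -(mem_rot k) def_s inE ys' orbT.
  exact: x_min.
case: s' s'_ge {def_s} => [|y t] // s'_ge; case/lastP: t s'_ge => [|t z] // s'_ge.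
rewrite /= rcons_path last_rcons => /andP[/orP xy /andP[_ /orP zx]].
move=> /andP[x_notin] /andP[y_notin _] _.
have ylt := s'_ge y (mem_head _ _).
have zlt : (x <= z)%N by apply: s'_ge; rewrite inE mem_rcons mem_head orbT.
have par_x (w : node) : (x <= w)%N -> par x = w \/ par w = x -> par x = w.
  by move=> xw [//|pw]; have := par_gt w; rewrite pw; lia.
have par_y : par x = y.
  by apply: par_x => //; case: xy => /eqP; [left|right].
have par_z : par x = z.
  by apply: par_x => //; case: zx => /eqP; [right|left].
have yz : y = z by apply: ord_inj; rewrite -par_y.
by rewrite yz mem_rcons mem_head in y_notin.
Qed.

(** If a vertex is in bags [i < j], it is in the parent of [i]: the smaller index
    can always be pushed up. *)
Lemma parent_tree_connected v (i j : node) : v \in bag i -> v \in bag j ->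
  connect [rel x y : node | [&& parent_adj x y, v \in bag x & v \in bag y]] i j.
Proof.
set e := (X in connect X); have e_sym : symmetric e.
  by move=> x y; rewrite /e /= parent_adj_sym; congr (_ && _); rewrite andbC.
have [k] := ubnP (size l - i + (size l - j)); elim: k i j => // k IH i j le_k vi vj.
wlog lt_ij : i j le_k vi vj / (i < j)%N.
  move=> W; have [|ji|/val_inj->] := ltngtP i j; [exact: W| |exact: connect0].
  by rewrite (sym_connect_sym e_sym); apply: W => //; lia.
have lt_i : (i.+1 < size l)%N by have := ltn_ord j; lia.
have [lt_p /subsetP sub_p] := par_spec lt_i; have gt_p := par_gt i.
have v_par : v \in bag (par i).
  apply: sub_p; rewrite inE vi mem_bag_union; apply/hasP; exists (bag j) => //.
  rewrite /bag -(subnKC lt_ij) -nth_drop mem_nth // size_drop.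
  by rewrite ltn_sub2r //; exact: ltn_ord.
have lt_k : (size l - par i + (size l - j) < k)%N by clear -le_k lt_p gt_p; lia.
apply: connect_trans (connect1 _) (IH (Ordinal lt_p) j lt_k v_par vj).
by rewrite /e /parent_adj /= eqxx vi.
Qed.

End RunningIntersectionTree.

Lemma treewidth_running_intersection (G : sgraph) (l : seq {set G}) (k : nat) :
  l != [::] -> running_intersection l ->
  (forall B, B \in l -> (#|B| <= k)%N) ->
  (forall v : G, has (fun B : {set G} => v \in B) l) ->
  (forall u v : G, adj u v -> has (fun B : {set G} => (u \in B) && (v \in B)) l) ->
  (treewidth G <= k.-1)%N.
Proof.
case: l => // B0 l0 _; set l := B0 :: l0 => l_run l_k l_v l_e.
pose T := parent_tree B0 l0; pose B (t : T) := nth finset.set0 l t.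
have B_l t : B t \in l by apply: mem_nth.
have node_of (p : pred {set G}) : has p l -> exists t : T, p (B t).
  move=> pl; have lt := pl; rewrite has_find in lt.
  by exists (Ordinal lt); apply: nth_find.
have width_k : (td_width B <= k.-1)%N.
  by rewrite /td_width -!subn1 leq_sub2r //; apply/bigmax_leqP => t _; apply: l_k.
apply: leq_trans width_k; rewrite /treewidth; case: ex_minnP => n _; apply.
apply/asboolP; exists T, B; split=> //; split.
- exact: parent_treeP.
- by move=> v; exact: (node_of _ (l_v v)).
- move=> e /imsetP[[u v]]; rewrite inE /= => uv ->.
  have [t /andP[ut vt]] := node_of _ (l_e _ _ uv).
  by exists t; rewrite subUset !sub1set ut vt.
- by move=> v s t vs vt; apply: parent_tree_connected.
Qed.

(** * Uncrossing minimum covers of cuts *)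

Section CutCovers.
Variable G : sgraph.
Implicit Types I J X Y : {set G}.

Definition covers_cut I J X : bool :=
  [forall x in I, forall y in J, adj x y ==> (x \in X) || (y \in X)].

Lemma covers_cutP I J X :
  reflect (forall x y, x \in I -> y \in J -> adj x y -> (x \in X) || (y \in X))
          (covers_cut I J X).
Proof.
apply: (iffP forall_inP) => [H x y xI yJ xy|H x xI].
  by have /forall_inP/(_ y yJ)/implyP := H x xI; apply.
by apply/forall_inP => y yJ; apply/implyP; apply: H.
Qed.

Lemma covers_cutC I J X : covers_cut I J X -> covers_cut J I X.
Proof.
move=> /covers_cutP H; apply/covers_cutP => x y xJ yI xy.
by rewrite orbC; apply: H => //; rewrite adj_sym.
Qed.

Definition min_cut_cover I J X : Prop :=
  covers_cut I J X /\ forall Y, covers_cut I J Y -> (#|X| <= #|Y|)%N.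

Lemma min_cut_coverC I J X : min_cut_cover I J X -> min_cut_cover J I X.
Proof. by case=> cX mX; split=> [|Y /covers_cutC]; [exact: covers_cutC|exact: mX]. Qed.

Lemma min_cut_cover_exists I J : exists X, min_cut_cover I J X.
Proof.
have cT : covers_cut I J [set: G] by apply/covers_cutP => x y; rewrite !inE.
by case: (arg_minnP (fun X : {set G} => #|X|) cT) => X cX mX; exists X.
Qed.

Definition uncross I1 J X X1 : {set G} := (X1 :|: (X :&: I1)) :\: (J :\: X).

(** Minimum covers of nested cuts can be nested: the complementary exchange,
    made in [X], yields a cover [X'] of the larger cut, and the sizes of both
    new covers add up to those of the old ones. *)
Lemma uncross_min_cover I J I1 J1 X X1 : [disjoint I & J] ->
  I1 \subset I -> J \subset J1 ->
  min_cut_cover I J X -> min_cut_cover I1 J1 X1 ->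
  min_cut_cover I1 J1 (uncross I1 J X X1).
Proof.
move=> /disjointFr dIJ /subsetP I1I /subsetP JJ1.
move=> [/covers_cutP cX minX] [/covers_cutP cX1 minX1].
pose X' := (X :\: (I1 :\: X1)) :|: (X1 :&: J).
have cX' : covers_cut I J X'.
  apply/covers_cutP => x y xI yJ xy; have xJ := dIJ _ xI.
  have yI1 : y \in I1 = false by apply/negP => /I1I /dIJ; rewrite yJ.
  rewrite !inE xJ yJ yI1 /=.
  have := cX _ _ xI yJ xy; case: (boolP (x \in I1)) => xI1 /=; last first.
    by case/orP => ->; rewrite ?andbF ?orbT.
  have := cX1 _ _ xI1 (JJ1 _ yJ) xy.
  by case: (x \in X1); case: (y \in X1); case: (x \in X); case: (y \in X).
have cX1' : covers_cut I1 J1 (uncross I1 J X X1).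
  apply/covers_cutP => x y xI1 yJ1 xy; have xI := I1I _ xI1; have xJ := dIJ _ xI.
  rewrite !inE xJ xI1 /=; have := cX1 _ _ xI1 yJ1 xy.
  case: (boolP (y \in J)) => yJ; last first.
    by rewrite !andbF /=; case/orP => ->; rewrite ?orbT.
  have := cX _ _ xI yJ xy.
  by case: (x \in X1); case: (y \in X1); case: (x \in X); case: (y \in X).
split=> // Y /minX1 le_Y; apply: leq_trans le_Y.
have card_sum (A : {set G}) : #|A| = \sum_v (v \in A).
  by rewrite -sum1_card big_mkcond; apply: eq_bigr => v _; case: (v \in A).
have : (#|uncross I1 J X X1| + #|X'| = #|X| + #|X1|)%N.
  rewrite !card_sum -!big_split; apply: eq_bigr => v _.
  rewrite /= !inE; case: (boolP (v \in I1)) => [/I1I/dIJ->|_].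
    by case: (v \in X1); case: (v \in X).
  by case: (v \in X1); case: (v \in X); case: (v \in J).
by have := minX _ cX'; clear; lia.
Qed.

End CutCovers.

(** * A tree decomposition along a triangulation *)

Section Sweep.
Variables (G : sgraph) (idx : G -> nat) (P : pred nat) (ok : nat -> nat -> Prop).
Variable w : nat.
Hypothesis idx_inj : injective idx.
Hypothesis P_idx : forall v, P (idx v).

Definition between a b : {set G} := [set v | (a < idx v < b)%N].
Definition beyond a b : {set G} := [set v | (idx v < a)%N || (b < idx v)%N].
Definition at_pos a : {set G} := [set v | idx v == a].
(** For a chord [ab] and a cover [X] of the edges that cross it, the
    [territory] is what the part of the decomposition behind [ab] has to deal
    with, and the [interface] is what it may share with the rest. *)
Definition interface a b (X : {set G}) : {set G} := at_pos a :|: at_pos b :|: X.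
Definition territory a b (X : {set G}) : {set G} := [set v | (a <= idx v <= b)%N] :|: X.

Hypothesis okP : forall a b, ok a b -> (a < b)%N /\
  exists2 Y, covers_cut (between a b) (beyond a b) Y & (#|Y| <= w)%N.

Lemma card_at_pos a : (#|at_pos a| <= 1)%N.
Proof.
by apply/card_le1_eqP => u v; rewrite !inE => /eqP <- /eqP /idx_inj.
Qed.

Lemma triangulated_ok a b : triangulated P ok a b -> ok a b.
Proof. by case. Qed.

(** The bag for the triangle [acb] holds the interfaces of its three sides; the
    bags behind [ac], and then those behind [cb], are added on top of it.  The
    running intersection property needs the covers [X1] of [ac] and [X2] of
    [cb] to be nested with [X] and with each other.  An edge between the regions behind [ac] and [cb]
    crosses both chords: it has an end in [X1] and one in [X2], so it lies in
    one of the two territories or in the new bag. *)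
Lemma extend_decomposition a b : triangulated P ok a b ->
  forall (X : {set G}) (l : seq {set G}),
  min_cut_cover (between a b) (beyond a b) X ->
  running_intersection l ->
  has (fun p : {set G} => interface a b X \subset p) l ->
  territory a b X :&: bag_union l \subset interface a b X ->
  exists l' : seq {set G},
    [/\ running_intersection (l' ++ l),
        forall B, B \in l' -> (#|B| <= 3 + 3 * w)%N /\ B \subset territory a b X,
        forall v, v \in territory a b X -> has (fun B : {set G} => v \in B) (l' ++ l) &
        forall u v, u \in territory a b X -> v \in territory a b X -> adj u v ->
          has (fun B : {set G} => (u \in B) && (v \in B)) (l' ++ l)].
Proof.
elim=> {a b} [a b okab side|a c b okab Pc acb T1 IH1 T2 IH2] X l mX rl hl tl.
  have [p pl /subsetP Sp] := hasP hl.
  have USp v : v \in territory a b X -> v \in p.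
    move=> vU; apply: Sp; move: vU; rewrite !inE => /orP[vab|->]; last by rewrite orbT.
    by have := side _ (P_idx v); move: vab; clear; lia.
  exists [::]; split=> //.
    by move=> v /USp vp; apply/hasP; exists p.
  by move=> u v /USp up /USp vp _; apply/hasP; exists p; rewrite ?up.
have [ab [Y cY leY]] := okP okab.
have [ac [Y1 cY1 leY1]] := okP (triangulated_ok T1).
have [cb [Y2 cY2 leY2]] := okP (triangulated_ok T2).
have Xw : (#|X| <= w)%N := leq_trans (mX.2 _ cY) leY.
set I1 := between a c; set J1 := beyond a c.
set I2 := between c b; set J2 := beyond c b.
set I := between a b; set J := beyond a b.
have dis x y : [disjoint between x y & beyond x y].
  by apply/pred0P => v; rewrite /= !inE; clear; lia.
have I1I : I1 \subset I by apply/subsetP => v; rewrite !inE; clear -acb; lia.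
have I2I : I2 \subset I by apply/subsetP => v; rewrite !inE; clear -acb; lia.
have JJ1 : J \subset J1 by apply/subsetP => v; rewrite !inE; clear -acb; lia.
have JJ2 : J \subset J2 by apply/subsetP => v; rewrite !inE; clear -acb; lia.
have I2J1 : I2 \subset J1 by apply/subsetP => v; rewrite !inE; clear -acb; lia.
have I1J2 : I1 \subset J2 by apply/subsetP => v; rewrite !inE; clear -acb; lia.
have [X10 mX10] := min_cut_cover_exists I1 J1.
have [X20 mX20] := min_cut_cover_exists I2 J2.
(* [X2] is uncrossed with [X], and then with [X1] seen as a cover of the
   reversed cut [(J1, I1)], as [I2] lies beyond [ac]. *)
pose X1 := uncross I1 J X X10.
pose X2a := uncross I2 J X X20.
pose X2 := uncross I2 I1 X1 X2a.
have mX1 : min_cut_cover I1 J1 X1 by apply: uncross_min_cover mX mX10.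
have mX2a : min_cut_cover I2 J2 X2a by apply: uncross_min_cover mX mX20.
have mX2 : min_cut_cover I2 J2 X2.
  apply: uncross_min_cover (min_cut_coverC mX1) mX2a => //.
  by rewrite disjoint_sym; apply: dis.
have X1w : (#|X1| <= w)%N := leq_trans (mX1.2 _ cY1) leY1.
have X2w : (#|X2| <= w)%N := leq_trans (mX2.2 _ cY2) leY2.
have XX1 v : v \in X -> v \in I1 -> v \in X1.
  by move=> vX vI1; rewrite !inE vX; move: vI1; rewrite !inE => ->; rewrite orbT.
have X1X v : v \in X1 -> v \in J -> v \in X.
  by rewrite !inE => /andP[+ _] vJ; rewrite vJ andbT negbK.
have XX2 v : v \in X -> v \in I2 -> v \in X2.
  move=> vX vI2; have vI1 : v \in I1 = false by move: vI2; rewrite !inE; clear; lia.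
  rewrite /X2 inE in_setD vI1 andbF inE /X2a !inE vX.
  by move: vI2; rewrite !inE => ->; rewrite !orbT.
have X2X v : v \in X2 -> v \in J -> v \in X.
  move=> + vJ; have vI2 : v \in I2 = false by move: vJ; rewrite !inE; clear -acb; lia.
  rewrite /X2 inE => /andP[_]; rewrite inE [v \in _ :&: _]inE vI2 andbF orbF.
  by rewrite inE => /andP[+ _]; rewrite inE vJ andbT negbK.
have X2X1 v : v \in X2 -> v \in I1 -> v \in X1.
  by rewrite /X2 inE => /andP[+ _] vI1; rewrite inE vI1 andbT negbK.
have X1X2 v : v \in X1 -> v \in I2 -> v \in X2.
  move=> vX1 vI2; have vI1 : v \in I1 = false by move: vI2; rewrite !inE; clear; lia.
  by rewrite /X2 inE in_setD vI1 andbF inE [v \in _ :&: _]inE vX1 vI2 orbT.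
have cut1 := elimT (covers_cutP _ _ _) mX1.1.
have cut2 := elimT (covers_cutP _ _ _) mX2.1.
clearbody X1 X2; clear X2a mX2a mX10 mX20.
pose U := territory a b X; pose U1 := territory a c X1; pose U2 := territory c b X2.
pose B := interface a b X :|: at_pos c :|: X1 :|: X2.
have trich v : [|| v \in I1, v \in I2,
    v \in at_pos a :|: at_pos b :|: at_pos c | v \in J].
  by rewrite !inE; clear; lia.
have inU v : (v \in U) = [|| (a <= idx v <= b)%N | v \in X] by rewrite !inE.
have inU1 v : (v \in U1) = [|| (a <= idx v <= c)%N | v \in X1] by rewrite !inE.
have inU2 v : (v \in U2) = [|| (c <= idx v <= b)%N | v \in X2] by rewrite !inE.
have inB v : (v \in B) = [|| v \in at_pos a :|: at_pos b :|: at_pos c,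
    v \in X, v \in X1 | v \in X2].
  by rewrite !inE -!orbA; do !bool_congr.
have BU : B \subset U.
  apply/subsetP => v; rewrite inB inU; case: (boolP (v \in J)) => vJ.
    case/or4P => [|->|/X1X/(_ vJ)->|/X2X/(_ vJ)->]; rewrite ?orbT //.
    by rewrite !inE; clear -acb ab; lia.
  by move=> _; move: vJ; rewrite !inE; clear; lia.
have U1U : U1 \subset U.
  apply/subsetP => v; rewrite inU1 inU; case: (boolP (v \in J)) => vJ.
    move: (vJ); rewrite !inE => vJ' /orP[|/X1X/(_ vJ)->]; rewrite ?orbT //.
    by clear -vJ' acb; lia.
  by move=> _; move: vJ; rewrite !inE; clear; lia.
have U2U : U2 \subset U.
  apply/subsetP => v; rewrite inU2 inU; case: (boolP (v \in J)) => vJ.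
    move: (vJ); rewrite !inE => vJ' /orP[|/X2X/(_ vJ)->]; rewrite ?orbT //.
    by clear -vJ' acb; lia.
  by move=> _; move: vJ; rewrite !inE; clear; lia.
have Bw : (#|B| <= 3 + 3 * w)%N.
  have cU (A C : {set G}) n k :
      (#|A| <= n)%N -> (#|C| <= k)%N -> (#|A :|: C| <= n + k)%N.
    by move=> An Ck; apply: leq_trans (leq_card_setU _ _) (leq_add An Ck).
  have := cU _ _ _ _ (cU _ _ _ _ (cU _ _ _ _ (cU _ _ _ _
    (cU _ _ _ _ (card_at_pos a) (card_at_pos b)) Xw) (card_at_pos c)) X1w) X2w.
  by move/leq_trans; apply; clear; lia.
have UlB v : v \in U -> v \in bag_union l -> v \in B.
  move=> vU vl; have := subsetP tl v; rewrite inE vU vl => /(_ isT).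
  by rewrite inB !inE => /orP[/orP[]|] ->; rewrite ?orbT.
have rB : running_intersection (B :: l).
  rewrite /= rl andbT; apply/orP; right; have [p pl Sp] := hasP hl.
  apply/hasP; exists p => //; apply: subset_trans Sp; apply: subset_trans tl.
  exact: setSI.
have in_side1 v : v \in U1 -> v \in I1 \/ v \in interface a c X1.
  by rewrite inU1 !inE => /orP[H|->]; [move: H; clear; lia|rewrite orbT; right].
have in_side2 v : v \in U2 -> v \in I2 \/ v \in interface c b X2.
  by rewrite inU2 !inE => /orP[H|->]; [move: H; clear; lia|rewrite orbT; right].
have BI1 v : v \in I1 -> v \in B -> v \in X1.
  move=> vI1; rewrite inB => /or4P[|/XX1|//|/X2X1]; auto.
  by move: vI1; rewrite !inE; clear -acb; lia.
have BI2 v : v \in I2 -> v \in B -> v \in X2.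
  move=> vI2; rewrite inB => /or4P[|/XX2|/X1X2|//]; auto.
  by move: vI2; rewrite !inE; clear -acb; lia.
have S1B : interface a c X1 \subset B.
  by apply/subsetP => v; rewrite inB !inE => /orP[/orP[]|] ->; rewrite ?orbT.
have S2B : interface c b X2 \subset B.
  by apply/subsetP => v; rewrite inB !inE => /orP[/orP[]|] ->; rewrite ?orbT.
have [||l1 [r1 b1 v1 e1]] := IH1 X1 (B :: l) mX1 rB.
- by rewrite /= S1B.
- apply/subsetP => v; rewrite inE => /andP[vU1 vBl]; case: (in_side1 _ vU1) => // vI1.
  rewrite inE (BI1 _ vI1) ?orbT //; move: vBl; rewrite mem_bag_union /= => /orP[//|].
  by rewrite -mem_bag_union; apply: UlB; apply: (subsetP U1U).
have [||l2 [r2 b2 v2 e2]] := IH2 X2 (l1 ++ B :: l) mX2 r1.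
- by rewrite has_cat /= S2B orbT.
- apply/subsetP => v; rewrite inE => /andP[vU2]; case: (in_side2 _ vU2) => // vI2.
  rewrite inE mem_bag_union has_cat => /orP[/hasP[C /b1[_ /subsetP CU1] /CU1 vU1]|vBl].
    suff vX1 : v \in X1 by rewrite (X1X2 _ vX1 vI2) orbT.
    by move: vU1 vI2; rewrite inU1 !inE => /orP[|//]; clear; lia.
  rewrite (BI2 _ vI2) ?orbT //; move: vBl => /= /orP[//|].
  by rewrite -mem_bag_union; apply: UlB; apply: (subsetP U2U).
have Bin : B \in l2 ++ l1 ++ B :: l by rewrite !mem_cat mem_head !orbT.
have lift1 p : has p (l1 ++ B :: l) -> has p (l2 ++ l1 ++ B :: l).
  by move=> pl1; rewrite has_cat pl1 orbT.
exists (l2 ++ l1 ++ [:: B]).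
have -> : (l2 ++ l1 ++ [:: B]) ++ l = l2 ++ l1 ++ B :: l by rewrite -!catA.
split=> //.
- move=> C; rewrite !mem_cat inE => /or3P[/b2[]|/b1[]|/eqP->] //.
    by move=> -> /subset_trans->.
  by move=> -> /subset_trans->.
- move=> v vU; case/or4P: (trich v) => [vI1|vI2|vabc|vJ].
  + by apply/lift1/v1; rewrite inU1; move: vI1; rewrite !inE; clear; lia.
  + by apply: v2; rewrite inU2; move: vI2; rewrite !inE; clear; lia.
  + by apply/hasP; exists B; rewrite ?inB ?vabc.
  apply/hasP; exists B; rewrite ?inB //; move: vU vJ; rewrite inU !inE.
  by case/orP => [|->]; rewrite ?orbT //; clear; lia.
pose joined (u v : G) :=
  has (fun C : {set G} => (u \in C) && (v \in C)) (l2 ++ l1 ++ B :: l).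
have joinedC u v : joined u v = joined v u by apply: eq_has => C; rewrite andbC.
have BB u v : u \in B -> v \in B -> joined u v.
  by move=> uB vB; apply/hasP; exists B; rewrite ?uB.
have UU1 u v : adj u v -> u \in U1 -> v \in U1 ->
    joined u v.
  by move=> uv uU vU; apply/lift1/e1.
have UU2 u v : adj u v -> u \in U2 -> v \in U2 ->
    joined u v.
  by move=> uv uU vU; apply: e2.
have mixed u v : u \in I1 -> v \in I2 -> adj u v ->
    joined u v.
  move=> uI1 vI2 uv.
  have uU1 : u \in U1 by move: uI1; rewrite inU1 !inE; clear; lia.
  have vU2 : v \in U2 by move: vI2; rewrite inU2 !inE; clear; lia.
  have := cut1 _ _ uI1 (subsetP I2J1 _ vI2) uv.
  case/orP => [uX1|vX1]; last by apply: UU1; rewrite // inU1 vX1 orbT.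
  have := cut2 _ _ vI2 (subsetP I1J2 _ uI1).
  rewrite adj_sym => /(_ uv)/orP[vX2|uX2]; last by apply: UU2; rewrite // inU2 uX2 orbT.
  by apply: BB; rewrite inB ?uX1 ?vX2 ?orbT.
have outB v : v \in U -> v \notin I1 :|: I2 -> v \in B.
  rewrite inU inE => vU; case/or4P: (trich v) => [->//|->|vabc _|vJ _];
    rewrite ?orbT //.
    by rewrite inB vabc.
  rewrite inB; case/orP: vU => [|->]; last by rewrite orbT.
  by move: vJ; rewrite !inE; clear; lia.
have edge_in u v : u \in I1 :|: I2 -> v \in U -> adj u v -> joined u v.
  move=> uI vU uv; have [vI|/(outB _ vU) vB] := boolP (v \in I1 :|: I2).
    move: uI vI; rewrite ![_ \in _ :|: _]inE => /orP[uI1|uI2] /orP[vI1|vI2].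
    - by apply: UU1 => //; rewrite inU1; move: uI1 vI1; rewrite !inE; clear; lia.
    - exact: mixed.
    - by rewrite joinedC; apply: mixed; rewrite // adj_sym.
    by apply: UU2 => //; rewrite inU2; move: uI2 vI2; rewrite !inE; clear; lia.
  move: uI; rewrite [_ \in _ :|: _]inE => /orP[uI1|uI2].
    have uU1 : u \in U1 by move: uI1; rewrite inU1 !inE; clear; lia.
    have [vU1|vU1] := boolP (v \in U1); first exact: UU1.
    have vJ1 : v \in J1 by move: vU1; rewrite inU1 !inE; clear; lia.
    have /orP[uX1|vX1] := cut1 _ _ uI1 vJ1 uv.
      by apply: BB; rewrite // inB uX1 !orbT.
    by rewrite inU1 vX1 orbT in vU1.
  have uU2 : u \in U2 by move: uI2; rewrite inU2 !inE; clear; lia.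
  have [vU2|vU2] := boolP (v \in U2); first exact: UU2.
  have vJ2 : v \in J2 by move: vU2; rewrite inU2 !inE; clear; lia.
  have /orP[uX2|vX2] := cut2 _ _ uI2 vJ2 uv.
    by apply: BB; rewrite // inB uX2 !orbT.
  by rewrite inU2 vX2 orbT in vU2.
move=> u v uU vU uv; rewrite -/(joined u v).
have [uI|/(outB _ uU) uB] := boolP (u \in I1 :|: I2); first exact: edge_in.
have [vI|/(outB _ vU) vB] := boolP (v \in I1 :|: I2); last exact: BB.
by rewrite joinedC; apply: edge_in; rewrite // adj_sym.
Qed.

(** Nothing is beyond the root chord, so its cover is empty. *)
Lemma treewidth_triangulation lo hi : triangulated P ok lo hi ->
  (forall v, (lo <= idx v <= hi)%N) -> (treewidth G <= 2 + 3 * w)%N.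
Proof.
move=> T idx_bnd.
have beyond0 : beyond lo hi = set0.
  by apply/setP => v; rewrite !inE; have := idx_bnd v; clear; lia.
have m0 : min_cut_cover (between lo hi) (beyond lo hi) set0.
  split; last by move=> Y _; rewrite cards0.
  by apply/covers_cutP => x y _; rewrite beyond0 inE.
pose S := interface lo hi set0.
have [|||l' [rl bl vl el]] := extend_decomposition T (l := [:: S]) m0.
- by [].
- by rewrite /= subxx.
- by rewrite /bag_union big_seq1 subsetIr.
have U v : v \in territory lo hi set0 by rewrite !inE idx_bnd.
have -> : 2 + 3 * w = (3 + 3 * w).-1 by [].
apply: (treewidth_running_intersection _ rl) => [|B||].
- by case: l' {rl bl vl el}.
- rewrite mem_cat inE => /orP[/bl[]//|/eqP->].
  rewrite /S /interface setU0; apply: leq_trans (leq_card_setU _ _) _.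
  by have := card_at_pos lo; have := card_at_pos hi; clear; lia.
- by move=> v; apply: vl.
by move=> u v; apply: el.
Qed.

End Sweep.

(** * Points in order on a circle *)

Section CircularOrder.
Import Order.TTheory GRing.Theory Num.Theory.
Local Open Scope ring_scope.
Variable R : realType.
Implicit Types p q : R * R.

Definition orientation p1 p2 p3 : R :=
  (p2.1 - p1.1) * (p3.2 - p1.2) - (p2.2 - p1.2) * (p3.1 - p1.1).

(** Diagonals of a convex quadrilateral; [a] and [b] come from Cramer's rule. *)
Lemma segments_meet p1 p2 p3 p4 :
  0 < orientation p1 p2 p3 -> 0 < orientation p2 p3 p4 ->
  0 < orientation p1 p2 p4 -> 0 < orientation p1 p3 p4 ->
  exists a b : R, [/\ 0 < a < 1, 0 < b < 1 &
    (1 - a) *: p1 + a *: p3 = (1 - b) *: p2 + b *: p4].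
Proof.
move=> o123 o234 o124 o134.
have D_gt0 : 0 < orientation p1 p2 p4 + orientation p2 p3 p4 by apply: addr_gt0.
have D_eq : orientation p1 p2 p4 + orientation p2 p3 p4 =
            orientation p1 p2 p3 + orientation p1 p3 p4.
  by rewrite /orientation; ring.
exists (orientation p1 p2 p4 / (orientation p1 p2 p4 + orientation p2 p3 p4)).
exists (orientation p1 p2 p3 / (orientation p1 p2 p4 + orientation p2 p3 p4)).
split.
- by rewrite divr_gt0 //= ltr_pdivrMr // mul1r ltrDl.
- by rewrite divr_gt0 //= ltr_pdivrMr // mul1r D_eq ltrDl.
have D_neq0 := lt0r_neq0 D_gt0.
move: D_neq0; clear; case: p1 p2 p3 p4 => [x1 y1] [x2 y2] [x3 y3] [x4 y4].
rewrite /orientation /= => D_neq0.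
have scale_pair (k x y : R) : k *: (x, y) = (k * x, k * y) by [].
have add_pair (x y x' y' : R) : (x, y) + (x', y') = (x + x', y + y') by [].
by rewrite !scale_pair !add_pair; congr (_, _); field.
Qed.

Lemma inner_point_neq p q a : p != q -> 0 < a < 1 ->
  (1 - a) *: p + a *: q != p /\ (1 - a) *: p + a *: q != q.
Proof.
move=> pq /andP[a0 a1].
have -> : (1 - a) *: p + a *: q = p + a *: (q - p).
  by rewrite scalerBl scale1r scalerBr addrA addrAC.
split.
  by rewrite -subr_eq0 addrC addKr scaler_eq0 subr_eq0 negb_or gt_eqF //= eq_sym.
rewrite -subr_eq0 addrAC -[p - q]opprB -scaleN1r -scalerDl scaler_eq0.
by rewrite negb_or !subr_eq0 (eq_sym q) pq andbT addrC subr_eq0 lt_eqF.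
Qed.

Definition bracket (a b : R * R) : R := a.1 * b.2 - b.1 * a.2.

Definition sqn (a : R * R) : R := a.1 ^+ 2 + a.2 ^+ 2.

(** The point of the circle whose stereographic projection from
    [(o.1 - r, o.2)] has slope [a.2 / a.1]: homogeneous coordinates make the
    centre of projection, with coordinates [(0, 1)], an ordinary point. *)
Definition circle_point (o : R * R) (r : R) (a : R * R) : R * R :=
  (o.1 + r * (a.1 ^+ 2 - a.2 ^+ 2) / sqn a, o.2 + r * (2 * a.1 * a.2) / sqn a).

Definition stereographic (o : R * R) (r : R) p : R * R :=
  if p.1 - o.1 == - r then (0, 1) else (r + (p.1 - o.1), p.2 - o.2).

(** One representative direction for each line through the origin, such that
    [bracket] orders these directions by their angle. *)
Definition right_half (a : R * R) : bool := (0 < a.1) || (a.1 == 0) && (0 < a.2).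

Lemma sqn_gt0 a : right_half a -> 0 < sqn a.
Proof.
rewrite /sqn => /orP[a1|/andP[_ a2]]; first by rewrite ltr_wpDr ?sqr_ge0 ?exprn_gt0.
by rewrite ltr_wpDl ?sqr_ge0 ?exprn_gt0.
Qed.

Section OneCircle.
Variables (o : R * R) (r : R).
Hypothesis r_gt0 : 0 < r.

Lemma stereographicK p : (p.1 - o.1) ^+ 2 + (p.2 - o.2) ^+ 2 = r ^+ 2 ->
  right_half (stereographic o r p) /\ circle_point o r (stereographic o r p) = p.
Proof.
case: p => x y /= circ; rewrite /stereographic /=; case: eqVneq => [pole|npole].
  split; first by rewrite /right_half /= eqxx ltr01 orbT.
  have y0 : y - o.2 = 0.
    by apply/eqP; rewrite -sqrf_eq0; apply/eqP; move: circ; rewrite pole; lra.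
  rewrite /circle_point /sqn /= expr0n expr1n /= !add0r !divr1.
  by congr (_, _); lra.
have s_gt0 : 0 < r + (x - o.1).
  rewrite lt_neqAle eq_sym addrC addr_eq0 npole /=.
  have : (x - o.1) ^+ 2 <= r ^+ 2 by rewrite -circ lerDl sqr_ge0.
  move=> le; rewrite leNgt; apply/negP => neg.
  have negr : x - o.1 - r < 0.
    by apply: le_lt_trans neg; rewrite lerD2l ge0_cp // ltW.
  have : 0 < (x - o.1 - r) * (x - o.1 + r) by rewrite nmulr_rgt0.
  by rewrite -subr_sqr subr_gt0 ltNge le.
split; first by rewrite /right_half /= s_gt0.
have q_eq : sqn (r + (x - o.1), y - o.2) = 2 * r * (r + (x - o.1)).
  by rewrite /sqn /=; move: circ; nra.
rewrite /circle_point q_eq /=.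
have ss : (r + (x - o.1)) ^+ 2 - (y - o.2) ^+ 2 = 2 * (x - o.1) * (r + (x - o.1)).
  by move: circ; nra.
have r0 := lt0r_neq0 r_gt0; have s0 := lt0r_neq0 s_gt0.
by rewrite ss; congr (_, _); field; apply/andP.
Qed.

(** The orientation factors like a Vandermonde determinant, so the signs of the
    brackets decide on which side of a line through two points of the circle a
    third point lies. *)
Lemma orientation_circle_point a b c :
  right_half a -> right_half b -> right_half c ->
  orientation (circle_point o r a) (circle_point o r b) (circle_point o r c) =
  4 * r ^+ 2 * bracket a b * bracket b c * bracket a c / (sqn a * sqn b * sqn c).
Proof.
move=> /sqn_gt0/lt0r_neq0 + /sqn_gt0/lt0r_neq0 + /sqn_gt0/lt0r_neq0.
rewrite /orientation /circle_point /bracket /sqn /= => a0 b0 c0.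
by field; rewrite a0 b0 c0.
Qed.

Lemma bracketC a b : bracket b a = - bracket a b.
Proof. by rewrite /bracket opprB; congr (_ - _); rewrite mulrC. Qed.

(** From [b.1 [a, c] = a.1 [b, c] + c.1 [a, b]], with all first coordinates
    nonnegative; [b.1 = 0] forces [c] to be vertical as well. *)
Lemma bracket_ge0_trans a b c : right_half a -> right_half b -> right_half c ->
  0 <= bracket a b -> 0 <= bracket b c -> 0 <= bracket a c.
Proof.
have fst_ge0 d : right_half d -> 0 <= d.1.
  by move=> /orP[/ltW//|/andP[/eqP->]].
move=> ha hb hc; have a1 := fst_ge0 _ ha; have c1 := fst_ge0 _ hc.
case/orP: hb => [b1 ab bc|/andP[/eqP b1 b2]].
  rewrite -(pmulr_rge0 _ b1).
  have -> : b.1 * bracket a c = a.1 * bracket b c + c.1 * bracket a b.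
    by rewrite /bracket; ring.
  by rewrite addr_ge0 ?mulr_ge0.
rewrite /bracket b1 !mul0r subr0 sub0r => _ cb.
have c0 : c.1 = 0.
  by apply: le_anti; rewrite c1 -(pmulr_lle0 _ b2) -oppr_ge0 cb.
rewrite c0 mul0r subr0 mulr_ge0 //.
by case/orP: hc => [|/andP[_ /ltW//]]; rewrite c0 ltxx.
Qed.

Lemma bracket_eq0 a b : right_half a -> right_half b -> bracket a b = 0 ->
  circle_point o r a = circle_point o r b.
Proof.
move=> ha hb /eqP; rewrite subr_eq0 => /eqP ab.
have := lt0r_neq0 (sqn_gt0 ha); have := lt0r_neq0 (sqn_gt0 hb).
case: a b ha hb ab => [s t] [s' t'] /=; rewrite /right_half /circle_point /sqn /=.
have [->|s0] := eqVneq s 0; have [->|s'0] := eqVneq s' 0.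
- rewrite ltxx /= => t_gt0 t'_gt0 _ _ _.
  by congr (_, _); field; rewrite !gt_eqF.
- rewrite ltxx /= => t0 _; rewrite mul0r => /esym/eqP; rewrite mulf_eq0 (negbTE s'0) /=.
  by rewrite gt_eqF.
- rewrite ltxx /= => _ t0; rewrite mul0r => /eqP; rewrite mulf_eq0 (negbTE s0) /=.
  by rewrite gt_eqF.
move=> _ _ ab q' q.
have def_t' : t' = s' * t / s by rewrite -ab mulrAC divff ?mul1r.
move: q'; rewrite {}def_t' => q'.
have q'' : (s' * s) ^+ 2 + (s' * t) ^+ 2 != 0.
  by rewrite !exprMn -mulrDr mulf_neq0 ?expf_neq0.
by congr (_, _); field; rewrite s0 q'' q.
Qed.

End OneCircle.


Lemma crosses_sym (G : topological_graph R) (e f : {set G}) :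
  crosses e f -> crosses f e.
Proof. by case=> ef [x [xe xf]]; split; [rewrite eq_sym|exists x]. Qed.

Section CircularGraph.
Variables (G : topological_graph R) (o : R * R) (r : R).
Hypothesis G_geometric : Defs.geometric G.
Hypothesis r_gt0 : 0 < r.
Hypothesis G_circle : forall v : G,
  ((pos v).1 - o.1) ^+ 2 + ((pos v).2 - o.2) ^+ 2 = r ^+ 2.

Let coord (v : G) := stereographic o r (pos v).
Let coord_half v : right_half (coord v).
Proof. by have [] := stereographicK r_gt0 (G_circle v). Qed.
Let coordK v : circle_point o r (coord v) = pos v.
Proof. by have [] := stereographicK r_gt0 (G_circle v). Qed.

Definition ccw_le : rel G := fun u v => 0 <= bracket (coord u) (coord v).

Definition circular_index (v : G) : nat := index v (sort ccw_le (enum G)).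

Lemma circular_index_inj : injective circular_index.
Proof.
move=> u v; rewrite /circular_index => e.
have mem w : w \in sort ccw_le (enum G) by rewrite mem_sort mem_enum.
by rewrite -(nth_index u (mem u)) e nth_index.
Qed.

Lemma circular_index_bracket u v : (circular_index u < circular_index v)%N ->
  0 < bracket (coord u) (coord v).
Proof.
move=> uv; have le_total : total ccw_le.
  by move=> x y; rewrite /ccw_le [bracket (coord y) _]bracketC oppr_ge0 le_total.
have le_trans : transitive ccw_le.
  by move=> y x z; apply: bracket_ge0_trans.
rewrite lt_neqAle; apply/andP; split.
  apply/eqP => /esym /(bracket_eq0 o r (coord_half u) (coord_half v)).
  rewrite !coordK => /pos_inj e; by rewrite e ltnn in uv.
apply: (sorted_ltn_index le_trans (sort_sorted le_total _)) uv;
  by rewrite mem_sort mem_enum.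
Qed.

Lemma orientation_index u v w :
  (circular_index u < circular_index v < circular_index w)%N ->
  0 < orientation (pos u) (pos v) (pos w).
Proof.
move=> /andP[uv vw]; rewrite -!coordK orientation_circle_point //.
have pos_b x y := @circular_index_bracket x y.
rewrite divr_gt0 ?mulr_gt0 ?exprn_gt0 ?sqn_gt0 // ?pos_b //.
exact: ltn_trans vw.
Qed.

Lemma inner_point_interior (u v : G) a : adj u v -> 0 < a < 1 ->
  curve_interior (@pos _ G) (@curve _ G) [set u; v]%SET
    ((1 - a) *: pos u + a *: pos v).
Proof.
move=> uv a01; have uNv : u != v by apply: contraTneq uv => ->; rewrite adj_irrefl.
have pos_uv : pos u != pos v by apply: contra uNv => /eqP/pos_inj->.
have [nu nv] := inner_point_neq pos_uv a01.
split.
  rewrite G_geometric //; exists a => //=.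
  by rewrite in_itv /=; case/andP: a01 => /ltW-> /ltW->.
case=> w /=; rewrite !inE => /orP[] /eqP-> e.
  by rewrite -e eqxx in nu.
by rewrite -e eqxx in nv.
Qed.

(** If [u < x < v < y] on the circle, the four orientations are positive and the
    segments meet at a point that is interior to both. *)
Lemma interleave_crosses (u v x y : G) : adj u v -> adj x y ->
  interleave (circular_index u) (circular_index v)
             (circular_index x) (circular_index y) ->
  crosses [set u; v]%SET [set x; y]%SET.
Proof.
have ordered a b c d : adj a c -> adj b d ->
    (circular_index a < circular_index b)%N ->
    (circular_index b < circular_index c)%N ->
    (circular_index c < circular_index d)%N -> crosses [set a; c]%SET [set b; d]%SET.
  move=> ac bd ab bc cd; split.
    apply/eqP => /setP/(_ a); rewrite !inE eqxx /= => /esym/orP[] /eqP e;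
    by move: ab bc cd; rewrite e; clear; lia.
  have [|||| s [t [s01 t01 st]]] := @segments_meet (pos a) (pos b) (pos c) (pos d);
    try by apply: orientation_index; lia.
  exists ((1 - s) *: pos a + s *: pos c); split; first exact: inner_point_interior.
  by rewrite st; apply: inner_point_interior.
wlog uv : u v / (circular_index u <= circular_index v)%N.
  move=> W; have [|/ltnW vu] := leqP (circular_index u) (circular_index v).
    exact: W.
  by rewrite interleaveCl setUC adj_sym; apply: W.
wlog xy : x y / (circular_index x <= circular_index y)%N.
  move=> W; have [|/ltnW yx] := leqP (circular_index x) (circular_index y).
    exact: W.
  by rewrite interleaveC [[set x; y]%SET]setUC [adj x y]adj_sym; apply: W.
move=> auv axy; rewrite /interleave /minn /maxn => H.
have [xu|ux] := ltnP (circular_index x) (circular_index u).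
  apply: crosses_sym; apply: ordered => //;
    by move: H uv xy xu; clear; do ?[case: ifP => ?]; lia.
by apply: ordered => //; move: H uv xy ux; clear; do ?[case: ifP => ?]; lia.
Qed.

End CircularGraph.
End CircularOrder.

(** * Covering the edges that cross a guarded chord *)

(** The vertices of a maximum matching. *)
Lemma matching_number_cover (V : finType) (F : {set {set V}}) (m : nat) :
  (forall f, f \in F -> (0 < #|f| <= 2)%N) -> (matching_number F <= m)%N ->
  exists2 Y : {set V}, (#|Y| <= 2 * m)%N &
    forall f, f \in F -> exists2 v, v \in f & v \in Y.
Proof.
move=> F2 Fm.
have M0 : (set0 \subset F) && finset.trivIset (set0 : {set {set V}}).
  by rewrite sub0set; apply/trivIsetP => A B; rewrite inE.
case: (@arg_maxnP _ set0 (fun M : {set {set V}} => (M \subset F) && finset.trivIset M)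
  (fun M => #|M|) M0) => M /andP[MF Mtriv] Mmax.
have Mm : (#|M| <= m)%N.
  apply: leq_trans Fm.
  apply: (@leq_bigmax_cond _ _ (fun M : {set {set V}} => #|M|)); exact/andP.
exists (finset.cover M).
  apply: leq_trans (leq_card_cover M) _; rewrite mulnC.
  apply: leq_trans (leq_mul Mm (leqnn 2)); rewrite -sum_nat_const.
  by apply: leq_sum => f fM; have /andP[] := F2 f (subsetP MF f fM).
move=> f fF; have [/pred0P dis|/pred0Pn[v /andP[vf vM]]] :=
  boolP [disjoint f & finset.cover M]; last by exists v.
have dis_f : {in M, forall B : {set V}, [disjoint f & B]}.
  move=> B BM; apply/pred0P => v /=; apply/negP => /andP[vf vB].
  have vM : v \in finset.cover M by apply/bigcupP; exists B.
  by have := dis v; rewrite /= vf vM.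
have M_n0 : set0 \notin M.
  by apply/negP => /(subsetP MF)/F2; rewrite cards0.
have [triv fM] := trivIsetU1 dis_f Mtriv M_n0.
have := Mmax (f |: M); rewrite triv subUset sub1set fF MF cardsU1 fM.
by move=> /(_ isT); rewrite /= add1n ltnn.
Qed.

Lemma bigcup_seq_card (T : eqType) (V : finType) (D : seq T)
    (K : T -> {set V}) (b : T -> nat) :
  (forall d, d \in D -> (#|K d| <= b d)%N) ->
  (#|\bigcup_(d <- D) K d| <= \sum_(d <- D) b d)%N.
Proof.
elim: D => [|d D IH] Kb; rewrite ?big_nil ?cards0 // !big_cons.
apply: leq_trans (leq_card_setU _ _) (leq_add (Kb _ (mem_head _ _)) (IH _)).
by move=> d' d'D; apply: Kb; rewrite inE d'D orbT.
Qed.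

(** By induction from the first colour [x > k]:
    [2 (c - x) + (c - x) (c - x - 1) = (c - x + 1) (c - x)], and
    [c - x + 1 <= c - k]. *)
Lemma colour_budget (c k : nat) (s : seq nat) : path ltn k s -> all (leq^~ c) s ->
  (\sum_(i <- s) 2 * (c - i) <= (c - k) * (c - k - 1))%N.
Proof.
elim: s k => [|x s IH] k; rewrite ?big_nil //= big_cons.
move=> /andP[kx /IH{}IH] /andP[xc /IH]; clear IH => IH.
apply: leq_trans (leq_add (leqnn _) IH) _.
have -> : (2 * (c - x) + (c - x) * (c - x - 1) = (c - x).+1 * (c - x))%N.
  by clear; case: (c - x) => // n; rewrite subn1 /=; nia.
by apply: leq_mul; clear -kx xc; lia.
Qed.

Section Colouring.
Variables (R : realType) (c m : nat) (G : topological_graph R).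
Variable phi : {set G} -> 'I_c.
Hypothesis phi_matching : forall i j : 'I_c, (i < j)%N ->
  forall e : {set G}, e \in edges G -> phi e = i ->
    (matching_number (crossing_edges_of_colour phi e j) <= m)%N.

Lemma edge_mem (u v : G) : adj u v -> [set u; v] \in edges G.
Proof. by move=> uv; apply/imsetP; exists (u, v); rewrite ?inE. Qed.

Lemma later_crossings_cover (e : {set G}) : e \in edges G ->
  exists2 Y : {set G}, (#|Y| <= m * (2 * (c - (phi e).+1)))%N &
    forall f, f \in edges G -> (phi e < phi f)%N -> crosses e f ->
      exists2 v, v \in f & v \in Y.
Proof.
move=> eE.
have Ex (j : 'I_c) : exists Y : {set G}, (phi e < j)%N ->
    (#|Y| <= 2 * m)%N /\ forall f, f \in crossing_edges_of_colour phi e j ->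
      exists2 v, v \in f & v \in Y.
  have [lt|] := boolP (phi e < j)%N; last by exists set0.
  have [|Y Y2 YF] := matching_number_cover _ (phi_matching lt eE erefl).
    move=> f; rewrite inE => /andP[/imsetP[[u v] /=]]; rewrite inE /= => uv -> _.
    by rewrite cards2; case: (_ == _).
  by exists Y.
have [Y YP] := choice Ex.
exists (\bigcup_(j : 'I_c | (phi e < j)%N) Y j); last first.
  move=> f fE ef cr; have [_ /(_ f)] := YP _ ef.
  case; first by rewrite inE fE eqxx; apply/asboolP.
  by move=> v vf vY; exists v => //; apply/bigcupP; exists (phi f).
have cardU : (#|\bigcup_(j : 'I_c | (phi e < j)%N) Y j| <=
    \sum_(j : 'I_c | (phi e < j)%N) 2 * m)%N.
  elim/big_rec2: _ => [|j n A ej An]; first by rewrite cards0.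
  by apply: leq_trans (leq_card_setU _ _) (leq_add (YP _ ej).1 An).
apply: leq_trans cardU _.
rewrite -(big_geq_mkord (phi e).+1 c xpredT (fun=> 2 * m)) sum_nat_const_nat.
by rewrite mulnC -mulnA mulnCA.
Qed.

End Colouring.

Theorem theorem1p20 (R : realType) (c m : nat) (G : topological_graph R)
    (phi : {set G} -> 'I_c) :
  (1 <= c)%N ->
  circular G ->
  transparent phi ->
  (forall i j : 'I_c, (i < j)%N ->
     forall e : {set G}, e \in edges G -> phi e = i ->
       (matching_number (crossing_edges_of_colour phi e j) <= m)%N) ->
  (treewidth G <= 9 * m * c * (c - 1) + 3 * c - 1)%N.
Proof.
move=> c_gt0 [G_geom [ctr [r [r_gt0 G_circ]]]] phi_transp phi_match.
pose idx : G -> nat := circular_index ctr r.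
have idx_inj : injective idx by apply: circular_index_inj.
pose set_of (p : G * G) : {set G} := [set p.1; p.2].
(* An edge appears as two labels, one for each orientation.  Colours are
   shifted by one so that all of them exceed the level [0] of every corner. *)
pose col (p : G * G) := (phi (set_of p)).+1.
pose es := sort (relpre col leq) [seq p <- enum [set: G * G] | adj p.1 p.2].
pose P (x : nat) := (x <= #|G|.+1)%N.
pose l (p : G * G) := idx p.1; pose rt (p : G * G) := idx p.2.
have mem_es p : (p \in es) = adj p.1 p.2.
  by rewrite mem_sort mem_filter mem_enum inE andbT.
have idx_lt v : (idx v < #|G|)%N.
  by rewrite cardE -(size_sort (ccw_le ctr r)) index_mem mem_sort mem_enum.
have es_edge p : p \in es -> set_of p \in edges G by rewrite mem_es; apply: edge_mem.
have cross p q : p \in es -> q \in es -> interleave (l p) (rt p) (l q) (rt q) ->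
    crosses (set_of p) (set_of q).
  by rewrite !mem_es => pE qE; apply: (interleave_crosses G_geom r_gt0 G_circ).
(* The last corner, [#|G|.+1], is no vertex: it makes the root chord
   nondegenerate for every number of vertices. *)
have T : triangulated P (guarded col es P l rt (fun=> 0)) 0 #|G|.+1.
  apply: guarded_triangulation => //.
  - by apply: sort_sorted => p q; apply: leq_total.
  - exact: leqnn.
  - by move=> p _; split; rewrite /P ltnW // ltnS ltnW // idx_lt.
  - move=> p q pE qE [eq_col]; apply/negP => /(cross _ _ pE qE).
    by apply: phi_transp; rewrite ?es_edge //; apply: val_inj.
have Kex p : exists Y : {set G}, p \in es ->
    (#|Y| <= m * (2 * (c - col p)))%N /\
    forall f, f \in edges G -> (phi (set_of p) < phi f)%N -> crosses (set_of p) f ->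
      exists2 v, v \in f & v \in Y.
  have [pE|] := boolP (p \in es); last by exists set0.
  by have [Y Yb YP] := later_crossings_cover phi_match (es_edge _ pE); exists Y.
have [K KP] := choice Kex.
have budget D k : {subset D <= es} -> path ltn k (map col D) ->
    (#|\bigcup_(d <- D) K d| <= m * (c * (c - 1)))%N.
  move=> DE Dp.
  apply: leq_trans (bigcup_seq_card (b := fun d => m * (2 * (c - col d))) _) _.
    by move=> d /DE/KP[].
  rewrite -big_distrr leq_mul2l /=; apply/orP; right.
  rewrite -(big_map col xpredT (fun i => 2 * (c - i))).
  apply: leq_trans (colour_budget Dp _) _.
    by apply/allP => _ /mapP[d _ ->]; apply: ltn_ord.
  by apply: leq_mul; lia.
have okP a b : guarded col es P l rt (fun=> 0) a b -> (a < b)%N /\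
    exists2 Y : {set G}, covers_cut (between idx a b) (beyond idx a b) Y &
      (#|Y| <= 2 * (m * (c * (c - 1))))%N.
  move=> [_ _ ab [Da [Db [sD pa pb D]]]]; split=> //.
  exists (\bigcup_(d <- Da ++ Db) K d); last first.
    rewrite big_cat /= mul2n -addnn; apply: leq_trans (leq_card_setU _ _) _.
    apply: leq_add; [apply: budget pa|apply: budget pb] => d dD; apply: sD;
      by rewrite mem_cat dD ?orbT.
  apply/covers_cutP => x y; rewrite !inE => xab yab xy.
  have gE : (x, y) \in es by rewrite mem_es.
  have gX : interleave a b (l (x, y)) (rt (x, y)).
    rewrite /interleave /l /rt /= (minn_idPl (ltnW ab)) (maxn_idPr (ltnW ab)).
    by rewrite xab yab.
  have [d dD [dg lt]] := D _ gE gX.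
  have [_ /(_ _ (es_edge _ gE) lt (cross _ _ (sD _ dD) gE dg)) [v vg vK]] :=
    KP _ (sD _ dD).
  have vU : v \in \bigcup_(d <- Da ++ Db) K d.
    by rewrite bigcup_seq; apply/bigcupP; exists d.
  by move: vg vU; rewrite /set_of !inE => /orP[] /eqP -> ->; rewrite ?orbT.
have P_idx v : P (idx v) by rewrite /P ltnW // ltnS ltnW.
have := treewidth_triangulation idx_inj P_idx okP T.
move=> /(_ _)/leq_trans; apply; first by move=> v; exact: P_idx.
have -> : (9 * m * c * (c - 1) = 9 * (m * (c * (c - 1))))%N by rewrite -!mulnA.
move: (m * (c * (c - 1)))%N c_gt0 => A; clear; lia.
Qed.
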